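(* Let $G$ be an $(n,d,\lambda)$-graph with $d>500\lambda$, with $n$ sufficiently large, and let $\mathcal{M}$ be a collection of pairwise disjoint pairs $\{x,y\}\subseteq V(G)$ (where $x=y$ is allowed) such that $V(\mathcal{M})$ is $500\lambda$-clean in $G$ and $|\mathcal{M}|\ge 2000\lambda n/d$. Let $\mathcal{P}$ be a collection of at most $\frac{|\mathcal{M}|}{100\log_2 n}$ pairwise disjoint pairs $\{a_i,b_i\}$ of vertices in $V(G)\setminus V(\mathcal{M})$ such that every vertex $v\in V(\mathcal{P})$ satisfies $|N(v)\cap V(\mathcal{M})|\ge 500\lambda$. Then there exist pairwise vertex-disjoint $\mathcal{M}$-alternating paths in $G\cup\mathcal{M}$, one between each pair $\{a_i,b_i\}\in\mathcal{P}$.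
   Context: An $(n,d,\lambda)$-graph is an $n$-vertex $d$-regular graph whose second largest eigenvalue in absolute value is at most $\lambda$. For a collection $\mathcal{M}$ of disjoint sets, $V(\mathcal{M})$ is the union of its members; $V(\mathcal{P})$ likewise. A set $S\subseteq V(G)$ is $\delta$-clean if $G[S]$ has minimum degree at least $\delta$. $N(v)$ is the neighbourhood of $v$ in $G$. $G\cup\mathcal{M}$ denotes the graph obtained from $G$ by adding the edge $xy$ for every pair $\{x,y\}\in\mathcal{M}$ with $x\ne y$ (if not already present). A path in $G\cup\mathcal{M}$ is $\mathcal{M}$-alternating if it is of the form $e_1f_1e_2f_2\dots$ where the $e_i$ are edges of $G$ and each $f_i$ is either an edge $xy$ with $\{x,y\}\in\mathcal{M}$, $x\neq y$, or a single vertex $x$ with $\{x,x\}\in\mathcal{M}$; i.e., every step through a pair of $\mathcal{M}$ is preceded and followed by an edge of $G$. *)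

(* Defs.v *)
From HB Require Import structures.
From mathcomp Require Import all_boot all_order all_algebra.
From mathcomp Require Import all_classical all_reals all_analysis.
Set Implicit Arguments. Unset Strict Implicit. Unset Printing Implicit Defensive.
Import Order.TTheory GRing.Theory Num.Theory.
Local Open Scope ring_scope.

Section Graphs.
Variable T : finType.

Definition simple_graph (e : rel T) := symmetric e /\ irreflexive e.

Definition nbhd (e : rel T) (v : T) : {set T} := [set u | e v u].

Definition regular (e : rel T) (d : nat) := forall v : T, #|nbhd e v| = d.

Definition adj_mx (R : nzRingType) (e : rel T) : 'M[R]_#|T| :=
  \matrix_(i, j) (e (enum_val i) (enum_val j))%:R.

(* Second largest eigenvalue in absolute value at most lam: listing the
   eigenvalues (roots of the characteristic polynomial, with multiplicity)
   in nonincreasing order lam_1 >= lam_2 >= ... >= lam_n, we have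
   |lam_i| <= lam for all i >= 2. *)
Definition second_eig_le (R : realFieldType) (e : rel T) (lam : R) :=
  exists s : seq R,
    [/\ char_poly (adj_mx R e) = \prod_(x <- s) ('X - x%:P),
        sorted (fun x y : R => y <= x) s &
        forall i, (1 <= i < size s)%N -> `|s`_i| <= lam].

Definition nd_lambda_graph (R : realFieldType) (e : rel T) (d : nat) (lam : R) :=
  [/\ simple_graph e, regular e d & second_eig_le e lam].

Definition clean (R : realFieldType) (e : rel T) (delta : R) (S : {set T}) :=
  forall v, v \in S -> delta <= (#|nbhd e v :&: S|)%:R.

(* An M-alternating path from a to b is encoded by the sequence s of the
   pairs of M it passes through, in order: each (x,y) in s means the path
   enters the pair {x,y} at x, uses the M-step x->y (or the single vertex
   x when x = y), and leaves at y.  Consecutive steps are joined by edges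
   of G: a--x_1, y_i--x_{i+1}, y_k--b (or a--b when s is empty). *)
Definition alt_vertices (a b : T) (s : seq (T * T)) : seq T :=
  a :: flatten [seq (if p.1 == p.2 then [:: p.1] else [:: p.1; p.2]) | p <- s]
    ++ [:: b].

Definition stop_vertices (s : seq (T * T)) : {set T} :=
  [set x | x \in flatten [seq [:: p.1; p.2] | p <- s]].

Definition alt_path (e : rel T) (M : {set {set T}}) (a b : T)
    (s : seq (T * T)) :=
  [/\ all (fun p => [set p.1; p.2] \in M) s,
      all (fun uv => e uv.1 uv.2) (zip (a :: map snd s) (rcons (map fst s) b))
    & uniq (alt_vertices a b s)].

End Graphs.

(* Main.v *)
Require Import Defs.
From HB Require Import structures.
From mathcomp Require Import all_boot all_order all_algebra.
From mathcomp Require Import all_classical all_reals all_analysis.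
From mathcomp Require Import complex fintype finset zify ring lra.
Set Implicit Arguments. Unset Strict Implicit. Unset Printing Implicit Defensive.
Import Order.TTheory GRing.Theory Num.Theory.
Local Open Scope ring_scope.

(* Put m = lam n / d.  By the expander mixing lemma any two vertex sets with
   more than m vertices are joined by an edge, and a set of at most 4m vertices,
   each having at least 500 lam neighbours in V(M), meets at least twice as many
   pairs of M as it has vertices.  The pairs a_i, b_i are linked one after
   another.  From a_i and then from b_i one grows a binary tree of alternating
   walks of depth h, where m < 2^h <= 2m, reserving each new pair of M for the
   vertex it is reached from, so that the twofold expansion of sets of size at
   most 2^(h+1) survives (the Friedman-Pippenger argument).  The two sets of
   2^h leaves are joined by an edge, which closes a path through 2h pairs.
   Releasing all pairs off that path keeps the expansion for the vertices that
   are still available, because a pair of the path is reserved for a vertex of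
   the path.  As 2h <= 2 log_2 n, all paths together use at most |M|/50 pairs, so
   sets of size between 2^h and 2^(h+1) always have room to spare. *)

(** * Expander mixing *)

Section SpectralGap.
Local Open Scope sesquilinear_scope.

Lemma char_poly_conj (F : fieldType) n (U A : 'M[F]_n) :
  U \in unitmx -> char_poly (invmx U *m A *m U) = char_poly A.
Proof.
move=> Ui; rewrite /char_poly.
have -> : char_poly_mx (invmx U *m A *m U) =
    map_mx polyC (invmx U) *m char_poly_mx A *m map_mx polyC U.
  rewrite /char_poly_mx mulmxBr mulmxBl !map_mxM; congr (_ - _).
  by rewrite scalar_mxC -mulmxA -map_mxM mulVmx // map_mx1 mulmx1.
rewrite !det_mulmx mulrAC -det_mulmx -map_mxM mulVmx //.
by rewrite map_mx1 det1 mul1r.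
Qed.

(** In a unitary eigenbasis at most one eigenvalue fails the bound [mu], and [d] does. So [w] lies
    on that axis, [y] has no component along it, and [A] stretches every other coordinate by at most
    [mu]. *)
Lemma normal_mx_gap (C : numClosedFieldType) n (A : 'M[C]_n) (mu d : C)
    (s : seq C) (w y : 'rV[C]_n) :
  A \is normalmx -> char_poly A = \prod_(x <- s) ('X - x%:P) ->
  (forall i, (1 <= i < size s)%N -> `|s`_i| <= mu) ->
  w *m A = d *: w -> w != 0 -> ~~ (`|d| <= mu) -> dotmx y w = 0 ->
  dotmx (y *m A) (y *m A) <= mu ^+ 2 * dotmx y y.
Proof.
move=> nA chA s_le wA w0 d_big yw.
set U := spectralmx A; set D := spectral_diag A.
have Uu : U \is unitarymx := spectral_unitarymx A.
have Ui : U \in unitmx := unitarymx_unit Uu.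
have AE : A = invmx U *m diag_mx D *m U by apply/orthomx_spectralP.
have UU : U *m U ^t* = 1%:M by apply/unitarymxP.
have dotU u v : dotmx (u *m U) (v *m U) = dotmx u v.
  by rewrite !dotmxE trmx_mul map_mxM mulmxA -(mulmxA u) UU mulmx1.
have chD : char_poly A = \prod_(x <- [seq D 0 i | i <- enum 'I_n]) ('X - x%:P).
  rewrite AE char_poly_conj // char_poly_trig ?diag_mx_is_trig //.
  rewrite big_map big_enum /=; apply: eq_bigr => i _.
  by rewrite !mxE eqxx mulr1n.
have Dperm : perm_eq s [seq D 0 i | i <- enum 'I_n].
  by apply: prod_XsubC_eq; rewrite -chA.
pose bad := [pred x : C | ~~ (`|x| <= mu)].
(* The bound on [s] starts at index 1, so only the head of [s] can be bad. *)
have bad1 : (count bad s <= 1)%N.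
  case: (s) s_le => // x s' s_le /=.
  suff -> : count bad s' = 0%N by rewrite addn0; case: (~~ _).
  apply/eqP; rewrite -leqn0 leqNgt -has_count -all_predC.
  apply/(all_nthP 0) => i si /=; rewrite negbK.
  exact: (s_le i.+1).
have badU i j : bad (D 0 i) -> bad (D 0 j) -> i = j.
  move=> bi bj; apply/eqP; apply: contraTT bad1 => nij.
  rewrite (permP Dperm) count_map -ltnNge.
  rewrite -size_filter.
  have : (size [:: i; j] <=
      size [seq k <- enum 'I_n | preim (fun l : 'I_n => D 0%R l) bad k])%N.
    apply: uniq_leq_size => [|k]; first by rewrite /= inE nij.
    by rewrite !inE mem_filter mem_enum andbT => /orP[] /eqP -> /=.
  by [].
have [b wE] : exists b, w = b *m U by exists (w *m invmx U); rewrite mulmxKV.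
have [c yE] : exists c, y = c *m U by exists (y *m invmx U); rewrite mulmxKV.
have bD i : b 0 i * D 0 i = d * b 0 i.
  have : b *m diag_mx D = d *: b.
    have := congr1 (mulmx^~ (invmx U)) wA.
    by rewrite AE wE -scalemxAl !mulmxA !mulmxK.
  by move/rowP/(_ i); rewrite mul_mx_diag !mxE => ->.
have [i0 bi0] : exists i, b 0 i != 0.
  apply/existsP; apply: contraNT w0; rewrite negb_exists => /forallP b0.
  rewrite wE (_ : b = 0) ?mul0mx //; apply/rowP => i; rewrite [RHS]mxE.
  by apply/eqP; rewrite -[_ == _]negbK.
have Dd i : b 0 i != 0 -> D 0 i = d.
  by move=> bi; apply: (mulfI bi); rewrite bD mulrC.
have good i : i != i0 -> `|D 0 i| <= mu.
  by apply: contraNT => bi; apply/eqP/badU => //=; rewrite Dd.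
have b_out i : i != i0 -> b 0 i = 0.
  move=> ni; apply/eqP; apply: contraNT ni => bi.
  by apply/eqP/badU; rewrite /= Dd.
have c0 : c 0 i0 = 0.
  move: yw; rewrite yE wE dotU dotmxE mxE (bigD1 i0) //= big1 => [|i ni].
    rewrite addr0 !mxE => /eqP; rewrite mulf_eq0 conjC_eq0 (negPf bi0) orbF.
    by move/eqP.
  by rewrite !mxE b_out // conjC0 mulr0.
have -> : y *m A = (c *m diag_mx D) *m U.
  by rewrite AE yE !mulmxA mulmxK.
rewrite [in leRHS]yE !dotU !dotmxE mul_mx_diag !mxE mulr_sumr; apply: ler_sum => i _.
rewrite !mxE -!normCK.
have [-> | ni] := eqVneq i i0; first by rewrite c0 mul0r normr0 !expr0n mulr0.
rewrite normrM exprMn mulrC ler_wpM2r ?exprn_ge0 //.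
by rewrite lerXn2r ?nnegrE ?good // (le_trans _ (good i ni)).
Qed.
End SpectralGap.

(** The spectral bound is used over the complex numbers with [w] the all-ones vector, of eigenvalue
    [d] by regularity; a function of sum zero is orthogonal to it. *)
Lemma adjacency_gap (R : realType) (T : finType) (e : rel T) (d : nat) (lam : R)
    (f : T -> R) :
  nd_lambda_graph e d lam -> 0 <= lam -> lam < d%:R -> \sum_u f u = 0 ->
  \sum_v (\sum_(u in nbhd e v) f u) ^+ 2 <= lam ^+ 2 * \sum_u f u ^+ 2.
Proof.
move=> [[esym _] ereg [s [chs _ s_le]]] lam0 lamd f0.
pose toC : {rmorphism R -> R[i]} := real_complex R.
have toC_real x : toC x \is Num.real by rewrite complex_real.
have toC_norm x : `|toC x| = toC `|x|.
  by rewrite normc_def /= expr0n /= addr0 sqrtr_sqr.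
pose A := map_mx toC (adj_mx R e).
pose y : 'rV[R[i]]_#|T| := \row_i toC (f (enum_val i)).
have AE i j : A i j = toC (e (enum_val i) (enum_val j))%:R by rewrite !mxE.
have nA : A \is normalmx.
  apply/normalmxP; suff -> : map_mx Num.conj A^T = A by [].
  by apply/matrixP => i j; rewrite !mxE (CrealP (toC_real _)) esym.
have sumE (F : T -> R) : \sum_(i < #|T|) F (enum_val i) = \sum_u F u.
  by rewrite -big_enum_val.
have [T0 | T_gt0] := posnP #|T|.
  by rewrite !big1 ?mulr0 // => v; have := fintype0 v T0.
have := @normal_mx_gap _ _ A (toC lam) (toC d%:R) (map toC s) (const_mx 1) y nA.
have -> : dotmx y y = toC (\sum_u f u ^+ 2).
  rewrite dotmxE mxE -(sumE (fun u => f u ^+ 2)) rmorph_sum; apply: eq_bigr => i _.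
  by rewrite !mxE (CrealP (toC_real _)) -rmorphM.
have -> : dotmx (y *m A) (y *m A) = toC (\sum_v (\sum_(u in nbhd e v) f u) ^+ 2).
  rewrite dotmxE mxE -(sumE (fun v => (\sum_(u in nbhd e v) f u) ^+ 2)) rmorph_sum.
  apply: eq_bigr => i _; have yA : (y *m A) 0 i = toC (\sum_(u in nbhd e (enum_val i)) f u).
    rewrite mxE [in RHS]big_mkcond /= -(sumE (fun u => if u \in _ then f u else 0)).
    rewrite rmorph_sum; apply: eq_bigr => j _.
    rewrite AE mxE inE esym -rmorphM; congr (toC _).
    by case: (e _ _); rewrite ?mulr1 ?mulr0.
  have -> : map_mx Num.conj (y *m A)^T i 0 = (y *m A) 0 i.
    by rewrite [LHS]mxE [X in Num.conj X]mxE yA (CrealP (toC_real _)).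
  by rewrite yA -rmorphM.
rewrite -rmorphXn -rmorphM => gap; rewrite -lecR; apply: gap.
- rewrite -map_char_poly chs rmorph_prod big_map; apply: eq_bigr => x _.
  by rewrite rmorphB /= map_polyX map_polyC.
- move=> i; rewrite size_map => /[dup] /andP[_ si] /s_le.
  by rewrite (nth_map 0) // toC_norm lecR.
- apply/rowP => i; rewrite !mxE mulr1 -(ereg (enum_val i)) -sum1_card natr_sum.
  rewrite [in RHS]big_mkcond /= -(sumE (fun u => if u \in _ then 1 else 0)).
  rewrite rmorph_sum; apply: eq_bigr => j _.
  by rewrite AE mxE mul1r inE esym; case: (e _ _).
- apply/eqP => /rowP /(_ (Ordinal T_gt0)); rewrite !mxE => /eqP.
  by rewrite oner_eq0.
- by rewrite toC_norm lecR ger0_norm ?ler0n // -ltNge.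
- rewrite dotmxE mxE -[RHS](rmorph0 toC) -f0 -sumE rmorph_sum.
  by apply: eq_bigr => i _; rewrite !mxE conjC1 mulr1.
Qed.

(** Cauchy-Schwarz against the constant 1, read off from the nonnegative sum of the squares of
    [N * g v - S]. *)
Lemma sqr_sum_le (R : realType) (T : finType) (B : {set T}) (g : T -> R) :
  (\sum_(v in B) g v) ^+ 2 <= #|B|%:R * \sum_(v in B) g v ^+ 2.
Proof.
have [-> | B0] := eqVneq B set0; first by rewrite !big_set0 mulr0 expr0n.
have N_gt0 : 0 < #|B|%:R :> R by rewrite ltr0n card_gt0.
set S := \sum_(v in B) g v; set N := #|B|%:R in N_gt0 *.
have : 0 <= \sum_(v in B) (N * g v - S) ^+ 2 by apply: sumr_ge0 => v _; exact: sqr_ge0.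
have -> : \sum_(v in B) (N * g v - S) ^+ 2 =
    N ^+ 2 * \sum_(v in B) g v ^+ 2 - 2 * N * S * S + S ^+ 2 * N.
  rewrite (eq_bigr (fun v => N ^+ 2 * g v ^+ 2 - 2 * N * S * g v + S ^+ 2)).
    by rewrite big_split /= sumrB -!mulr_sumr sumr_const -[S *+ _]mulr_natr mulrA -expr2.
  by move=> v _; ring.
have -> : N ^+ 2 * \sum_(v in B) g v ^+ 2 - 2 * N * S * S + S ^+ 2 * N =
   N * (N * (\sum_(v in B) g v ^+ 2) - S ^+ 2) by ring.
by rewrite pmulr_rge0 // subr_ge0.
Qed.

Definition edges_between (T : finType) (e : rel T) (A B : {set T}) :=
  (\sum_(v in B) #|nbhd e v :&: A|)%N.

(** The gap is applied to the indicator of [A] minus its mean [alpha], a function of sum zero;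
    Cauchy-Schwarz over [B] then bounds the deviation. *)
Lemma expander_mixing (R : realType) (T : finType) (e : rel T) (d : nat) (lam : R)
    (A B : {set T}) :
  nd_lambda_graph e d lam -> 0 <= lam -> lam < d%:R ->
  ((edges_between e A B)%:R - d%:R * #|A|%:R * #|B|%:R / #|T|%:R) ^+ 2
    <= lam ^+ 2 * (#|A|%:R * #|B|%:R).
Proof.
move=> G lam0 lamd; have [_ ereg _] := G.
have [T0 | T_gt0] := posnP #|T|.
  have -> : B = set0 by apply/setP => v; have := fintype0 v T0.
  by rewrite /edges_between big_set0 cards0 mulr0 mul0r subrr expr0n !mulr0.
have nT : #|T|%:R != 0 :> R by rewrite pnatr_eq0 -lt0n.
pose alpha : R := #|A|%:R / #|T|%:R.
pose f u : R := (u \in A)%:R - alpha.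
have sA : \sum_u (u \in A)%:R = #|A|%:R :> R.
  by rewrite -sum1_card natr_sum [RHS]big_mkcond; apply: eq_bigr => u _; case: (u \in A).
have constE (c : R) : \sum_(u : T) c = c * #|T|%:R.
  by rewrite sumr_const -[LHS]mulr_natr.
have f0 : \sum_u f u = 0.
  by rewrite sumrB sA constE divfK // subrr.
have f2 : \sum_u f u ^+ 2 <= #|A|%:R.
  have -> : \sum_u f u ^+ 2 = \sum_u (u \in A)%:R
      - 2 * alpha * \sum_u (u \in A)%:R + \sum_(u : T) alpha ^+ 2.
    rewrite mulr_sumr -sumrB -big_split; apply: eq_bigr => u _ /=.
    by rewrite /f; case: (u \in A) => /=; ring.
  rewrite sA constE.
  have -> : #|A|%:R - 2 * alpha * #|A|%:R + alpha ^+ 2 * #|T|%:R =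
    #|A|%:R - alpha ^+ 2 * #|T|%:R.
    by rewrite /alpha; field.
  by rewrite gerBl mulr_ge0 ?sqr_ge0.
have := adjacency_gap G lam0 lamd f0.
set g := fun v => \sum_(u in nbhd e v) f u => gap.
have -> : (edges_between e A B)%:R - d%:R * #|A|%:R * #|B|%:R / #|T|%:R = \sum_(v in B) g v.
  have -> : \sum_(v in B) g v = \sum_(v in B) (#|nbhd e v :&: A|%:R - d%:R * alpha).
    apply: eq_bigr => v _; rewrite /g sumrB sumr_const ereg mulr_natl; congr (_ - _).
    rewrite -sum1_card natr_sum [RHS]big_mkcond [LHS]big_mkcond; apply: eq_bigr => u _.
    by rewrite in_setI; case: (u \in nbhd e v) => //=; case: (u \in A).
  rewrite sumrB sumr_const /edges_between natr_sum /alpha -[_ *+ #|B|]mulr_natr.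
  by congr (_ - _); field.
apply: (le_trans (sqr_sum_le B g)).
rewrite mulrA mulrC; apply: ler_wpM2r => //.
have : \sum_(v in B) g v ^+ 2 <= \sum_v g v ^+ 2.
  rewrite [leRHS](bigID (mem B)) /= lerDl; apply: sumr_ge0 => v _; exact: sqr_ge0.
move/le_trans; apply; apply: (le_trans gap).
by rewrite ler_wpM2l ?sqr_ge0.
Qed.

(** * Extending while preserving expansion *)

Section DoubleExpansion.
Local Open Scope nat_scope.
Variables A B : finType.
Implicit Types (r : A -> B -> bool) (X Y : {set A}).

Definition nb r X : {set B} := [set b | [exists x in X, r x b]].

(** The range [2 * k] covers the union of two sets of size at most [k], as the submodularity
    argument requires. *)
Definition expands r Y k :=
  forall X, X \subset Y -> #|X| <= 2 * k -> 2 * #|X| <= #|nb r X|.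

Lemma nbP r X b : reflect (exists2 x, x \in X & r x b) (b \in nb r X).
Proof. by rewrite inE; apply: exists_inP. Qed.

Lemma nbU r X X' : nb r (X :|: X') = nb r X :|: nb r X'.
Proof.
apply/setP => b; rewrite in_setU; apply/nbP/orP => [[x]|].
  by rewrite in_setU => /orP[] xX rxb; [left | right]; apply/nbP; exists x.
by case=> /nbP[x xX rxb]; exists x; rewrite // in_setU xX ?orbT.
Qed.

Lemma nb_sub r r' X X' :
  (forall x b, x \in X -> r x b -> r' x b) -> X \subset X' -> nb r X \subset nb r' X'.
Proof.
move=> rr' /subsetP XX'; apply/subsetP => b /nbP[x xX rxb].
by apply/nbP; exists x; [exact: XX' | exact: rr'].
Qed.

Lemma eq_expands r r' Y k : r =2 r' -> expands r Y k -> expands r' Y k.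
Proof.
move=> rr' H X XY Xk; apply: leq_trans (H X XY Xk) _.
by apply/subset_leq_card/nb_sub => // x b _; rewrite rr'.
Qed.

(* Sets meeting the expansion bound with equality ("critical" sets) are closed
   under union, because [X |-> #|nb r X|] is submodular.  An element of [nb r
   [set v]] outside the neighbourhood of the largest critical set avoiding [v]
   can therefore be reserved for [v]. *)
Lemma reserve_neighbor r Y k v (C : {set B}) :
  0 < k -> expands r Y k ->
  (forall X, X \subset Y -> k < #|X| <= 2 * k -> 2 * #|X| < #|nb r X|) ->
  v \in Y -> #|C| <= 1 ->
  exists b, [/\ r v b, b \notin C &
    expands (fun x b' => r x b' && ((b' == b) ==> (x == v))) Y k].
Proof.
move=> k0 rY slack vY C1.
pose crit X := [&& X \subset Y, v \notin X, #|X| <= k & #|nb r X| == 2 * #|X|].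
have crit0 : crit set0.
  rewrite /crit sub0set in_set0 cards0 /= muln0 cards_eq0.
  by apply/eqP/setP => b; rewrite in_set0; apply/negP => /nbP[x]; rewrite in_set0.
have critU X X' : crit X -> crit X' -> crit (X :|: X').
  move=> /and4P[XY vX Xk /eqP cX] /and4P[X'Y vX' X'k /eqP cX'].
  have UY : X :|: X' \subset Y by rewrite subUset XY.
  have UI := cardsUI X X'; have := cardsUI (nb r X) (nb r X').
  rewrite -nbU => nbUI.
  have nbI : 2 * #|X :&: X'| <= #|nb r X :&: nb r X'|.
    apply: leq_trans (_ : #|nb r (X :&: X')| <= _).
      apply: rY; first exact: subset_trans (subsetIl _ _) XY.
      by have := subset_leq_card (subsetIl X X'); lia.
    by apply: subset_leq_card; rewrite subsetI !nb_sub ?subsetIl ?subsetIr.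
  have U2k : #|X :|: X'| <= 2 * k by lia.
  have nbUle := rY _ UY U2k.
  (* A larger union would expand strictly by [slack], whereas submodularity forces equality. *)
  have Uk : #|X :|: X'| <= k.
    rewrite leqNgt; apply/negP => Uk; have := slack _ UY.
    by rewrite Uk U2k => /(_ isT); lia.
  by rewrite /crit UY in_setU negb_or vX vX' Uk /=; apply/eqP; lia.
pose Z := \bigcup_(X | crit X) X.
have /and4P[ZY vZ Zk /eqP cZ] : crit Z.
  by exact: (big_ind (fun X => is_true (crit X)) crit0 critU (fun _ h => h)).
(* Expansion gives [v |: Z] at least [2 * #|Z| + 2] neighbours, one more than [C :|: nb r Z] can
   contain. *)
have [b] : exists b, b \in nb r [set v] :\: (C :|: nb r Z).
  apply/set0Pn; rewrite setD_eq0; apply/negP => sub.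
  have : 2 * #|v |: Z| <= #|nb r (v |: Z)|.
    apply: rY; first by rewrite subUset sub1set vY.
    by rewrite cardsU1 vZ; lia.
  rewrite cardsU1 vZ leqNgt => /negP; apply.
  apply: leq_ltn_trans (_ : #|C :|: nb r Z| < _).
    by apply: subset_leq_card; rewrite nbU subUset sub subsetUr.
  by have := cardsUI C (nb r Z); lia.
rewrite in_setD in_setU negb_or => /andP[/andP[bC bZ] /nbP[v']].
rewrite in_set1 => /eqP -> rvb; exists b; split=> // X XY Xk.
(* If [X] contains [v], nothing is lost, because [v] itself still reaches [b]; otherwise only [b]
   can be lost. *)
have [vX | vX] := boolP (v \in X).
  apply: leq_trans (rY X XY Xk) _; apply/subset_leq_card/subsetP => b'.
  move=> /nbP[x xX rxb']; apply/nbP; have [-> | nb'] := eqVneq b' b.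
    by exists v; rewrite // rvb eqxx.
  by exists x; rewrite // rxb'.
have : #|nb r X :\ b| <= #|nb (fun x b' => r x b' && ((b' == b) ==> (x == v))) X|.
  apply/subset_leq_card/subsetP => b'; rewrite in_setD1 => /andP[nb'].
  by move=> /nbP[x xX rxb']; apply/nbP; exists x; rewrite // rxb' (negPf nb').
have D1 := cardsD1 b (nb r X); have rX := rY X XY Xk.
have [bX | bX] := boolP (b \in nb r X); last first.
  by rewrite (negPf bX) add0n in D1; rewrite -D1; apply: leq_trans.
have {}D1 : #|nb r X| = #|nb r X :\ b|.+1 by rewrite D1 bX.
(* Losing [b] breaks the bound only if [X] is critical; then [X] lies in [Z], and [b] would be a
   neighbour of [Z]. *)
apply: leq_trans; rewrite -ltnS -D1 ltn_neqAle rX andbT.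
apply: contra bZ => /eqP cX; apply: subsetP bX; apply: nb_sub => //.
apply: (bigcup_max X) => //; rewrite /crit XY vX cX eqxx andbT /=.
rewrite leqNgt; apply/negP => kX; have := slack X XY.
by rewrite kX Xk cX ltnn => /(_ isT).
Qed.

End DoubleExpansion.

(** * Growing reserved trees and linking one pair *)

Section Linking.
Local Open Scope nat_scope.
Variables (T : finType) (e : rel T).
Implicit Types (N : {set {set T}}) (par : {set T} -> option T) (p : T * T)
  (s : seq (T * T)) (a v x : T).

Definition hit N x (B : {set T}) := (B \in N) && [exists y in B, e x y].

Definition pair_set p : {set T} := [set p.1; p.2].

(* [par B = Some v] records that the pair [B] is reserved for the vertex [v]. *)
Definition avail N par x (B : {set T}) :=
  hit N x B && (if par B is Some z then x == z else true).

Definition reserved N par := [set B in N | par B != None].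

Definition nreserved N par : nat := #|reserved N par|.

Definition assign par (B : {set T}) v (B' : {set T}) :=
  if B' == B then Some v else par B'.

Definition extends par par' := forall B v, par B = Some v -> par' B = Some v.

Lemma cards_le2_in (B : {set T}) x : #|B| <= 2 -> x \in B -> exists y, B = [set x; y].
Proof.
move=> B2 xB; have B1 : #|B :\ x| <= 1 by rewrite (cardsD1 x) xB in B2.
(* The default [x] serves the singleton case, where [B] equals [[set x; x]]. *)
exists (odflt x [pick y in B :\ x]); apply/setP => z; rewrite in_set2.
case: pickP => [y yB | noB] /=.
  have /cards1P[w BE] : #|B :\ x| == 1.
    by rewrite eqn_leq B1; apply/card_gt0P; exists y.
  have yw : y = w by apply/set1P; rewrite -BE.
  have [-> | nzx] := eqVneq z x; first by [].
  by rewrite -[z == y]in_set1 yw -BE in_setD1 nzx.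
have [-> | nzx] := eqVneq z x; first by [].
by have := noB z; rewrite in_setD1 nzx.
Qed.

Lemma snd_pair_set p : p.2 \in pair_set p. Proof. by rewrite in_set2 eqxx orbT. Qed.

Variables (N : {set {set T}}) (Y : {set T}) (k : nat).
Hypothesis N_le2 : forall B, B \in N -> #|B| <= 2.
Hypothesis N_triv : trivIset N.
Hypothesis NY : cover N \subset Y.
Hypothesis k_gt0 : 0 < k.
Hypothesis hit_slack : forall X : {set T}, X \subset Y -> k < #|X| <= 2 * k ->
  2 * #|X| + 4 * k < #|nb (hit N) X|.

Lemma mem_pair_eq B B' x : B \in N -> B' \in N -> x \in B -> x \in B' -> B = B'.
Proof.
move=> BN B'N xB xB'; apply/eqP; apply: contraT => nBB'.
have /trivIsetP /(_ B B' BN B'N nBB') := N_triv.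
by move/disjoint_setI0/setP/(_ x); rewrite in_setI xB xB' in_set0.
Qed.

(** With at most [4 * k] pairs reserved, [hit_slack] leaves strict expansion among the available
    ones, so one more can be reserved. Forbidding the pairs that [v] already owns makes the pair
    found unreserved. *)
Lemma assign_step par v :
  expands (avail N par) Y k -> nreserved N par <= 4 * k -> v \in Y ->
  #|[set B in N | par B == Some v]| <= 1 ->
  exists p, [/\ pair_set p \in N, par (pair_set p) = None, e v p.1 &
    expands (avail N (assign par (pair_set p) v)) Y k].
Proof.
move=> parY par4k vY v1.
have slack (X : {set T}) : X \subset Y -> k < #|X| <= 2 * k ->
    2 * #|X| < #|nb (avail N par) X|.
  move=> XY Xk; have := hit_slack XY Xk.
  have : nb (hit N) X \subset nb (avail N par) X :|: reserved N par.
    apply/subsetP => B /nbP[x xX xB]; rewrite in_setU; have [BN _] := andP xB.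
    case parB: (par B) => [z|]; first by rewrite [B \in reserved _ _]in_set BN parB orbT.
    by apply/orP; left; apply/nbP; exists x; rewrite // /avail xB parB.
  move/subset_leq_card/leq_trans => /(_ (#|nb (avail N par) X| + 4 * k)) H.
  have {}H := H (leq_trans (leq_trans (eq_leq (cardsU _ _)) (leq_subr _ _))
    (leq_add (leqnn _) par4k)).
  by lia.
have [B [/andP[/andP[BN /exists_inP[y yB vy]] parB] Bv H]] :=
  reserve_neighbor k_gt0 parY slack vY v1.
have [z BE] := cards_le2_in (N_le2 BN) yB.
exists (y, z); rewrite /pair_set /= -BE; split=> //.
  case parBE: (par B) parB => [w|] // /eqP vw.
  by rewrite in_set BN parBE vw eqxx in Bv.
apply: eq_expands H => x B'; rewrite /avail /assign.
have [-> | nB'] := eqVneq B' B; last by rewrite andbT.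
case parBE: (par B) parB => [w|] //= /eqP vw.
  by rewrite in_set BN parBE vw eqxx in Bv.
by rewrite andbT.
Qed.

Lemma reserved_assign par B v : nreserved N (assign par B v) <= (nreserved N par).+1.
Proof.
apply: leq_trans (_ : #|B |: reserved N par| <= _); last first.
  by rewrite cardsU1 -add1n leq_add2r leq_b1.
apply/subset_leq_card/subsetP => B'; rewrite in_setU1 ![_ \in reserved _ _]in_set /assign.
by case: (B' == B).
Qed.

Definition cur a s := if s is p :: _ then p.2 else a.

(* Walks are stored in reverse: the head of [s] is the pair visited last. *)
Fixpoint valid par a s :=
  if s is p :: s' then
    [&& pair_set p \in N, par (pair_set p) == Some (cur a s'),
        e (cur a s') p.1 & valid par a s']
  else true.

Lemma valid_extends par par' a s : extends par par' -> valid par a s -> valid par' a s.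
Proof.
move=> ext; elim: s => //= p s IHs /and4P[-> /eqP /ext -> -> /IHs ->].
by rewrite eqxx.
Qed.

Lemma valid_mem par a s p : valid par a s -> p \in s ->
  pair_set p \in N /\
  exists2 v, par (pair_set p) = Some v & v = a \/ exists2 q, q \in s & v = q.2.
Proof.
elim: s => //= q s IHs /and4P[qN /eqP qpar _ /IHs {}IHs].
rewrite in_cons => /orP[/eqP -> | /IHs[pN [v pv vs]]].
  split=> //; exists (cur a s) => //; case: (s) => [|r s']; [by left | right].
  by exists r; rewrite // !in_cons eqxx orbT.
split=> //; exists v => //; case: vs => [-> | [r rs ->]]; [by left | right].
by exists r; rewrite // in_cons rs orbT.
Qed.

(** Two new pairs are reserved for the end of each walk in turn. An end that owned nothing before
    has one forbidden pair at its second turn, which [assign_step] tolerates. *)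
Lemma grow_layer a par (ss : seq (seq (T * T))) :
  expands (avail N par) Y k -> nreserved N par + 2 * size ss <= 4 * k ->
  uniq (map (cur a) ss) ->
  (forall s, s \in ss -> cur a s \in Y /\ forall B, par B <> Some (cur a s)) ->
  exists par' ss',
    [/\ expands (avail N par') Y k, extends par par',
        nreserved N par' <= nreserved N par + 2 * size ss,
        size ss' = 2 * size ss & uniq (map (cur a) ss')] /\
    [/\ (forall t, t \in ss' -> exists p s, [/\ t = p :: s, s \in ss, pair_set p \in N,
           par (pair_set p) = None & par' (pair_set p) = Some (cur a s) /\ e (cur a s) p.1])
      & (forall B v, par' B = Some v -> par B = Some v \/ exists2 s, s \in ss & v = cur a s)].
Proof.
elim: ss par => [|s ss IHs] par parY szss.
  move=> _ _; exists par, [::]; split; split=> //; first by rewrite muln0 addn0.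
  by left.
rewrite /= in szss * => /andP[s_ss ss_uniq] ssY.
have [sY par_s] := ssY s (mem_head _ _); set v := cur a s in s_ss sY par_s.
have [p1 [p1N p1None vp1 par1Y]] : exists p, [/\ pair_set p \in N, par (pair_set p) = None,
    e v p.1 & expands (avail N (assign par (pair_set p) v)) Y k].
  apply: assign_step => //; first by lia.
  rewrite (_ : [set _ in _ | _] = set0) ?cards0 //; apply/setP => B.
  by rewrite in_set in_set0; apply/negP => /andP[_ /eqP h]; case: (par_s B).
set par1 := assign par (pair_set p1) v in par1Y.
have par1_le : nreserved N par1 <= (nreserved N par).+1 := reserved_assign _ _ _.
have [p2 [p2N p2None vp2 par2Y]] : exists p, [/\ pair_set p \in N, par1 (pair_set p) = None,
    e v p.1 & expands (avail N (assign par1 (pair_set p) v)) Y k].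
  apply: assign_step => //; first by lia.
  rewrite -(cards1 (pair_set p1)); apply/subset_leq_card/subsetP => B.
  rewrite in_set => /andP[_ Bv]; apply/set1P; move: Bv; rewrite /par1 /assign.
  by case: (eqVneq B (pair_set p1)) => // _ /eqP h; case: (par_s B).
set par2 := assign par1 (pair_set p2) v in par2Y.
have par2_le : nreserved N par2 <= (nreserved N par1).+1 := reserved_assign _ _ _.
have par2_old B w : par2 B = Some w -> par B = Some w \/ w = v.
  rewrite /par2 /par1 /assign; case: eqVneq => [_ [<-] | _]; first by right.
  by case: eqVneq => [_ [<-] | _ ->]; [right | left].
have par2p2 : par2 (pair_set p2) = Some v by rewrite /par2 /assign eqxx.
have p21 : pair_set p1 != pair_set p2.
  by apply/eqP => E; move: p2None; rewrite -E /par1 /assign eqxx.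
have par2p1 : par2 (pair_set p1) = Some v by rewrite /par2 /par1 /assign (negPf p21) eqxx.
have ext2 : extends par par2.
  move=> B w Bw; rewrite /par2 /par1 /assign.
  case: eqVneq => [E|_]; first by move: p2None; rewrite -E /par1 /assign Bw; case: ifP.
  by case: eqVneq => [E|_ //]; move: p1None; rewrite -E Bw.
have [||par' [ss' [[par'Y ext' par'_le szss' uss'] [ss'P par'_old]]]] :=
  IHs par2 par2Y _ ss_uniq.
- by move: szss par1_le par2_le; clear; lia.
- move=> t tss; have [|tY par_t] := ssY t; first by rewrite in_cons tss orbT.
  split=> // B /par2_old [/par_t // | tv]; case/negP: s_ss.
  by rewrite -tv; apply: map_f.
(* Pairs entered later are unreserved in [par2], hence differ from those of [p1] and [p2];
   disjointness of pairs separates the ends. *)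
have fresh p : pair_set p \in N -> par2 (pair_set p) <> None -> p.2 \notin map (cur a) ss'.
  move=> pN pS; apply/mapP => -[t /ss'P [q [t' [-> _ qN qNone _]]] /= pq].
  apply: pS; rewrite (mem_pair_eq pN qN (snd_pair_set p)) // pq; exact: snd_pair_set.
exists par', [:: p1 :: s, p2 :: s & ss']; split; split=> //=.
- by move=> B w /ext2 /ext'.
- by move: par1_le par2_le par'_le; clear; lia.
- by move: szss'; clear; lia.
- rewrite in_cons negb_or uss' !fresh ?par2p1 ?par2p2 // !andbT.
  apply: contra p21 => /eqP E; apply/eqP.
  by apply: (mem_pair_eq p1N p2N (snd_pair_set p1)); rewrite E; exact: snd_pair_set.
- move=> t; rewrite !in_cons => /or3P[/eqP -> | /eqP -> | /ss'P].
  + by exists p1, s; rewrite mem_head (ext' _ _ par2p1).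
  + exists p2, s; rewrite mem_head (ext' _ _ par2p2); split=> //.
    by move: p2None; rewrite /par1 /assign eq_sym (negPf p21).
  + move=> [p [t' [-> t'ss pN pNone H]]]; exists p, t'; rewrite in_cons t'ss orbT.
    split=> //; case E: (par (pair_set p)) => [w|] //.
    by move: (ext2 _ _ E); rewrite pNone.
- move=> B w /par'_old [/par2_old [] | [t tss ->]]; first by left.
    by move=> ->; right; exists s; rewrite ?mem_head.
  by right; exists t; rewrite // in_cons tss orbT.
Qed.

(** Guarantees that the vertices of an unreserved pair own nothing, so that a newly reached leaf can
    still be given two children. *)
Definition closed_reservation par :=
  forall B B' v, par B = Some v -> B' \in N -> v \in B' -> par B' <> None.

(** Depth [h] reserves 2 + 4 + ... + 2^h = 2^(h+1) - 2 pairs, whence the summands 2. An arbitrary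
    starting [par0] lets a second tree grow on top of the first. *)
Lemma grow_tree a par0 h :
  a \in Y -> a \notin cover N -> expands (avail N par0) Y k ->
  (forall B, par0 B <> Some a) -> closed_reservation par0 ->
  nreserved N par0 + 2 * 2 ^ h <= 4 * k + 2 ->
  exists par ss,
    [/\ expands (avail N par) Y k, extends par0 par, closed_reservation par,
        nreserved N par + 2 <= nreserved N par0 + 2 * 2 ^ h &
        forall B v, par B = Some v -> [\/ par0 B = Some v, v = a | v \in cover N]] /\
    [/\ size ss = 2 ^ h, uniq (map (cur a) ss),
        (forall s B, s \in ss -> par B <> Some (cur a s)) &
        forall s, s \in ss -> [/\ size s = h, valid par a s, uniq (map pair_set s) &
          forall p, p \in s -> par0 (pair_set p) = None]].
Proof.
move=> aY aN par0Y par0a par0_closed.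
elim: h => [|h IHh] hk.
  exists par0, [:: [::]]; split; split=> //; first by constructor 1.
    by move=> s B; rewrite inE => /eqP -> /=.
  by move=> s; rewrite inE => /eqP ->.
have [|par [ss [[parY ext par_closed par_le par_old] [szss ss_uniq ss_own ssP]]]] := IHh.
  by move: hk; clear; rewrite expnS; lia.
have cur_cases s : s \in ss -> cur a s = a \/
    exists2 B : {set T}, cur a s \in B & B \in N /\ par B <> None.
  move=> /ssP [_ sval _ _]; case: s sval => [|p s] /=; first by left.
  by case/and4P=> pN /eqP pS _ _; right; exists (pair_set p); rewrite ?snd_pair_set ?pS.
have in_coverN (B : {set T}) v : B \in N -> v \in B -> v \in cover N.
  by move=> BN vB; apply/bigcupP; exists B.
have curY s : s \in ss -> cur a s \in Y.
  move=> /cur_cases [-> // | [B sB [BN _]]].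
  exact: (subsetP NY) (in_coverN _ _ BN sB).
have [||par' [ss' [[par'Y ext' par'_le szss' uss'] [ss'P par'_old]]]] :=
  @grow_layer a par ss parY _ ss_uniq.
- by rewrite szss; move: hk par_le; clear; rewrite expnS; lia.
- by move=> s sss; split; [exact: curY | move=> B; exact: ss_own].
exists par', ss'; split; split=> //.
- by move=> B v /ext /ext'.
- move=> B B' v /par'_old [parB | [s sss ->]] B'N vB'.
    have := par_closed _ _ _ parB B'N vB'.
    by case E: (par B') => [w|] // _; rewrite (ext' _ _ E).
  case: (cur_cases s sss) => [sa | [C sC [CN parC]]].
    by case/negP: aN; rewrite -sa; exact: in_coverN vB'.
  rewrite (mem_pair_eq B'N CN vB' sC).
  by case E: (par C) parC => [w|] // _; rewrite (ext' _ _ E).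
- by move: par_le par'_le; rewrite szss expnS; clear; lia.
- move=> B v /par'_old [/par_old // | [s sss ->]].
  case: (cur_cases s sss) => [-> | [C sC [CN _]]]; first by constructor 2.
  by constructor 3; exact: in_coverN sC.
- by rewrite szss' szss expnS.
(* A new leaf owns nothing: an older reservation for [p.2] contradicts closedness, and an owner from
   this layer is the root, outside [cover N], or lies in a pair reserved before. *)
- move=> t B /ss'P [p [s [-> _ pN pNone _]]] /= /par'_old [parB | [s1 s1ss s1p]].
    exact: par_closed parB pN (snd_pair_set p) pNone.
  case: (cur_cases s1 s1ss) => [sa | [C sC [CN parC]]].
    by case/negP: aN; rewrite -sa -s1p; exact: in_coverN pN (snd_pair_set p).
  by apply: parC; rewrite -(mem_pair_eq pN CN (snd_pair_set p)) // s1p.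
- move=> t /ss'P [p [s [-> sss pN pNone [pS ep]]]].
  have [szs sval sun s0] := ssP s sss; split=> /=.
  + by rewrite szs.
  + by rewrite pN pS eqxx ep (valid_extends ext').
  + rewrite sun andbT; apply/mapP => -[q qs pq].
    by have [_ [w qw _]] := valid_mem sval qs; rewrite -pq pNone in qw.
  + move=> q; rewrite in_cons => /orP[/eqP -> | /s0 //].
    by case E: (par0 (pair_set p)) => [w|] //; rewrite (ext _ _ E) in pNone.
Qed.

Definition alt_edges a s v :=
  all (fun uv => e uv.1 uv.2) (zip (a :: map snd s) (rcons (map fst s) v)).

Lemma alt_edges_rev par a s t v :
  valid par a s -> alt_edges (cur a s) t v -> alt_edges a (rev s ++ t) v.
Proof.
elim: s t => // p s IHs t /and4P[_ _ ep sval] tE.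
by rewrite rev_cons cat_rcons; apply: IHs => //; apply/andP.
Qed.

Definition swap p := (p.2, p.1).

(** Walking back from the leaf to the root meets the stored pairs in list order, each crossed from
    exit to entry. *)
Lemma alt_edges_swap par a t v : symmetric e ->
  valid par a t -> e v (cur a t) -> alt_edges v (map swap t) a.
Proof.
move=> esym; elim: t v => [|p t IHt] v /=; first by rewrite /alt_edges /= andbT.
by case/and4P=> _ _ ep tval ev; apply/andP; split=> //; apply: IHt; rewrite // esym.
Qed.

Lemma link_pair a b h :
  symmetric e -> k = 2 ^ h ->
  (forall X X' : {set T}, k <= #|X| -> k <= #|X'| ->
    exists x x', [/\ x \in X, x' \in X' & e x x']) ->
  a \in Y -> b \in Y -> a \notin cover N -> b \notin cover N -> a != b ->
  expands (hit N) Y k ->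
  exists s, let W := [set B in map pair_set s] in
    [/\ all (fun p => pair_set p \in N) s, uniq (map pair_set s), size s = 2 * h,
        alt_edges a s b &
        expands (hit (N :\: W)) (Y :\: ([set a; b] :|: cover W)) k].
Proof.
move=> esym kE joined aY bY aN bN ab NY_exp.
pose par0 (B : {set T}) : option T := None.
have par0_res : nreserved N par0 = 0.
  by apply/eqP; rewrite cards_eq0; apply/eqP/setP => B; rewrite in_set in_set0 andbF.
have par0Y : expands (avail N par0) Y k.
  by apply: eq_expands NY_exp => x B; rewrite /avail andbT.
have par0k : nreserved N par0 + 2 * 2 ^ h <= 4 * k + 2.
  by rewrite par0_res -kE; clear; lia.
have [//|//|par1 [ss1 [[par1Y _ par1_closed par1_le par1_old] [szss1 ss1_uniq _ ss1P]]]] :=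
  grow_tree aY aN par0Y _ _ par0k.
have par1b B : par1 B <> Some b.
  move=> /par1_old [//|ba|]; last by rewrite (negPf bN).
  by rewrite ba eqxx in ab.
(* The first tree holds at most [2 * k - 2] reservations, which leaves room for a second one. *)
have par1k : nreserved N par1 + 2 * 2 ^ h <= 4 * k + 2.
  by move: par1_le; rewrite par0_res -kE; clear; lia.
have [par2 [ss2 [[par2Y ext2 _ _ _] [szss2 ss2_uniq _ ss2P]]]] :=
  grow_tree bY bN par1Y par1b par1_closed par1k.
have [||x1 [x2 []]] := joined [set x in map (cur a) ss1] [set x in map (cur b) ss2].
- by rewrite cardsE (card_uniqP ss1_uniq) size_map szss1 kE.
- by rewrite cardsE (card_uniqP ss2_uniq) size_map szss2 kE.
rewrite !in_set => /mapP[s1 s1ss ->] /mapP[s2 s2ss ->] ecur.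
have [szs1 val1 uniq1 _] := ss1P s1 s1ss.
have [szs2 val2 uniq2 new2] := ss2P s2 s2ss.
pose s := rev s1 ++ map swap s2.
have pair_set_swap : map pair_set (map swap s2) = map pair_set s2.
  by rewrite -map_comp; apply: eq_map => p; rewrite /pair_set /= setUC.
have mem_W B : B \in map pair_set s -> exists2 p, B = pair_set p & p \in s1 \/ p \in s2.
  rewrite map_cat pair_set_swap map_rev mem_cat mem_rev.
  by case/orP=> /mapP[p ps ->]; exists p => //; [left | right].
have W_mem p : p \in s1 \/ p \in s2 -> pair_set p \in map pair_set s.
  rewrite map_cat pair_set_swap map_rev mem_cat mem_rev.
  by case=> ps; apply/orP; [left | right]; exact: map_f.
have val12 : valid par2 a s1 by exact: valid_extends val1.
exists s; split.
- apply/allP => p ps; have /mem_W[q -> [qs|qs]] : pair_set p \in map pair_set s.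
    by exact: map_f.
    by have [] := valid_mem val1 qs.
  by have [] := valid_mem val2 qs.
(* The pairs of [s1] are reserved in [par1], where those of [s2] are still unreserved, so the two
   walks share no pair. *)
- rewrite map_cat pair_set_swap map_rev cat_uniq rev_uniq uniq1 uniq2 andbT /=.
  apply/hasPn => B /mapP[p ps2 ->]; rewrite mem_rev; apply/mapP => -[q qs1 pq].
  by have [_ [w qw _]] := valid_mem val1 qs1; rewrite -pq new2 in qw.
- by rewrite size_cat size_rev size_map szs1 szs2; clear; lia.
- by apply: alt_edges_rev val1 _; exact: alt_edges_swap val2 _.
move=> X XY X2k.
have XY' : X \subset Y by apply: subset_trans XY (subsetDl _ _).
(* Each pair of the path is reserved for [a], [b] or an exit vertex of the path, none of them in
   [X]; so no pair available to [X] under [par2] lies in [W]. *)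
apply: leq_trans (par2Y X XY' X2k) _; apply: subset_leq_card.
apply/subsetP => B /nbP[x xX /andP[/andP[BN xB] parB]].
apply/nbP; exists x; rewrite // /hit xB andbT in_setD BN andbT.
have /(subsetP XY) := xX; rewrite in_setD => /andP[xout _].
apply: contra xout; rewrite in_set => /mem_W[p pE ps].
have inW q : q \in s1 \/ q \in s2 -> q.2 \in cover [set B in map pair_set s].
  move=> qs; apply/bigcupP; exists (pair_set q); last exact: snd_pair_set.
  by rewrite in_set W_mem.
rewrite !in_setU !in_set1.
case: ps => ps;
  [have [_ [v pv vE]] := valid_mem val12 ps | have [_ [v pv vE]] := valid_mem val2 ps];
  move: parB; rewrite pE pv => /eqP ->; case: vE => [-> | [q qs ->]].
- by rewrite eqxx.
- by rewrite inW ?orbT //; left.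
- by rewrite eqxx orbT.
- by rewrite inW ?orbT //; right.
Qed.

End Linking.

(** * Linking all pairs in turn *)

Section LinkPairs.
Local Open Scope nat_scope.
Variables (T : finType) (e : rel T) (M P : {set {set T}}).
Hypothesis M_size : forall B, B \in M -> 0 < #|B| <= 2.
Hypothesis M_triv : trivIset M.

Lemma mem_cover (B : {set T}) (N : {set {set T}}) x : B \in N -> x \in B -> x \in cover N.
Proof. by move=> BN xB; apply/bigcupP; exists B. Qed.

Lemma coverS (N N' : {set {set T}}) : N \subset N' -> cover N \subset cover N'.
Proof.
by move/subsetP=> NN'; apply/subsetP => x /bigcupP[B /NN' BN' xB]; exact: mem_cover xB.
Qed.

Lemma uniq_alt_vertices a b s :
  all (fun p => pair_set p \in M) s -> uniq (map (@pair_set T) s) ->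
  a \notin cover M -> b \notin cover M -> a != b -> uniq (alt_vertices a b s).
Proof.
move=> sM sU aM bM ab; pose fl (t : seq (T * T)) :=
  flatten [seq (if p.1 == p.2 then [:: p.1] else [:: p.1; p.2]) | p <- t].
have fl_mem t x : x \in fl t -> exists2 p, p \in t & x \in pair_set p.
  move/flatten_mapP => [p pt xp]; exists p => //; move: xp; rewrite in_set2.
  by case: ifP => _; rewrite !inE // => ->.
have fl_cover t x : all (fun p => pair_set p \in M) t -> x \in fl t -> x \in cover M.
  by move=> /allP tM /fl_mem[p /tM pM xp]; exact: mem_cover xp.
have flU t : all (fun p => pair_set p \in M) t -> uniq (map (@pair_set T) t) -> uniq (fl t).
  elim: t => // p t IHt /= /andP[pM tM] /andP[pt tU].
  rewrite /fl /= cat_uniq -/(fl t) IHt // andbT; apply/andP; split.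
    by case: ifP => // /negbT np; rewrite /= inE np.
  apply/hasPn => x /fl_mem[q qt xq]; apply: contra pt => xp.
  rewrite (_ : pair_set p = pair_set q) ?map_f //.
  apply: (@mem_pair_eq T M M_triv _ _ x pM (allP tM q qt)) => //; rewrite in_set2.
  by move: xp; case: ifP => _; rewrite !inE // => ->.
rewrite /alt_vertices -/(fl s) cons_uniq mem_cat mem_seq1 (negPf ab) orbF.
rewrite cat_uniq flU //= orbF andbT; apply/andP; split.
  by apply: contra aM; exact: fl_cover.
by apply: contra bM; exact: fl_cover.
Qed.

Lemma stop_vertices_sub s : stop_vertices s \subset cover [set B in map (@pair_set T) s].
Proof.
apply/subsetP => x; rewrite in_set => /flatten_mapP[p ps xp].
apply: (@mem_cover (pair_set p)); first by rewrite in_set map_f.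
by move: xp; rewrite !inE.
Qed.

Variable k : nat.
Hypothesis e_joined : forall X X' : {set T}, k <= #|X| -> k <= #|X'| ->
  exists x x', [/\ x \in X, x' \in X' & e x x'].

(** The missed pairs are disjoint and nonempty, so [k] of them would cover at least [k] vertices,
    and an edge from [X] would reach one. *)
Lemma few_missed (X : {set T}) : k <= #|X| -> #|M :\: nb (hit e M) X| < k.
Proof.
move=> kX; rewrite ltnNge; apply/negP => kD; set D := M :\: _ in kD.
have DM : D \subset M := subsetDl _ _.
have [|x [x' [xX /bigcupP[B BD x'B] exx']]] := e_joined kX (_ : k <= #|cover D|).
  apply: leq_trans kD _; rewrite -(eqP (trivIsetS DM M_triv)) -sum1_card.
  by apply: leq_sum => B BD; have /andP[] := M_size (subsetP DM B BD).
move: BD; rewrite in_setD => /andP[/negP BX BM]; apply: BX.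
by apply/nbP; exists x; rewrite // /hit BM; apply/exists_inP; exists x'.
Qed.

Lemma expands_sub (A B : finType) (r : A -> B -> bool) (Y Y' : {set A}) l :
  Y' \subset Y -> expands r Y l -> expands r Y' l.
Proof. by move=> YY' rY X XY'; apply: rY; exact: subset_trans YY'. Qed.

Variable h : nat.
Hypothesis kE : k = 2 ^ h.
Hypothesis e_sym : symmetric e.
Hypothesis P_size : forall B, B \in P -> #|B| = 2.
Hypothesis P_triv : trivIset P.
Hypothesis PM : [disjoint cover P & cover M].
Hypothesis M_expands : expands (hit e M) (cover M :|: cover P) k.
Hypothesis M_large : #|P| * (2 * h) + 9 * k <= #|M|.

Lemma cover_disj x : x \in cover P -> x \notin cover M.
Proof. by move=> xP; rewrite (disjointFr PM xP). Qed.

Let linked B (s : seq (T * T)) := exists a b, B = [set a; b] /\ alt_path e M a b s.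
Let trace f (B : {set T}) := B :|: stop_vertices (f B).

Lemma link_seq (ps : seq {set T}) : uniq ps -> {subset ps <= P} ->
  exists (f : {set T} -> seq (T * T)) (W : {set {set T}}),
  [/\ W \subset M, #|W| <= size ps * (2 * h),
      expands (hit e (M :\: W))
        ((cover M :|: cover P) :\: (cover W :|: cover [set B in ps])) k,
      (forall B, B \in ps -> linked B (f B) /\ stop_vertices (f B) \subset cover W) &
      (forall B B', B \in ps -> B' \in ps -> B != B' -> [disjoint trace f B & trace f B'])].
Proof.
elim: ps => [|B ps IHps].
  move=> _ _; exists (fun=> [::]), set0; split; rewrite ?sub0set ?cards0 //.
  rewrite setD0; apply: expands_sub M_expands; exact: subsetDl.
move=> /andP[Bps ps_uniq] psP.
have BP : B \in P by apply: psP; exact: mem_head.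
have {}psP C : C \in ps -> C \in P by move=> Cps; apply: psP; rewrite in_cons Cps orbT.
have [f [W [WM Wle WY fps fdisj]]] := IHps ps_uniq psP.
set N := M :\: W in WY; set Y := _ :\: _ in WY.
have NM : N \subset M := subsetDl _ _.
have N_triv : trivIset N := trivIsetS NM M_triv.
have psP' : [set C in ps] \subset P.
  by apply/subsetP => C; rewrite in_set; exact: psP.
have ps_size : size ps < #|P|.
  rewrite -(card_uniqP ps_uniq); apply: proper_card.
  by apply/properP; split; [exact/subsetP | exists B].
have NY : cover N \subset Y.
  apply/subsetP => x /bigcupP[C]; rewrite in_setD => /andP[CW CM] xC.
  have xM := mem_cover CM xC.
  rewrite in_setD !in_setU negb_or xM /= andbT; apply/andP; split.
    apply: contra CW => /bigcupP[D DW xD].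
    by rewrite (mem_pair_eq M_triv CM (subsetP WM D DW) xC xD).
  by apply: contraL xM => /(subsetP (coverS psP')); exact: cover_disj.
have BY x : x \in B -> x \in Y.
  move=> xB; have xP := mem_cover BP xB.
  rewrite in_setD !in_setU negb_or xP orbT andbT; apply/andP; split.
    by apply: contra (cover_disj xP); apply/subsetP; exact: coverS.
  apply: contra Bps => /bigcupP[D]; rewrite in_set => Dps xD.
  rewrite (mem_pair_eq P_triv BP _ xB xD) //.
  by apply: (subsetP psP'); rewrite in_set.
(* Fewer than [k] pairs of [M] are missed by [X], and at most [size ps * (2 * h)] are used up. The
   [9 * k] of [M_large] pays for these [k], for [2 * #|X| <= 4 * k] and for the slack [4 * k]. *)
have slack (X : {set T}) : X \subset Y -> k < #|X| <= 2 * k ->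
    2 * #|X| + 4 * k < #|nb (hit e N) X|.
  move=> _ /andP[kX X2k].
  have : M \subset (M :\: nb (hit e M) X) :|: (W :|: nb (hit e N) X).
    apply/subsetP => C CM; rewrite in_setU in_setD CM andbT.
    case: (boolP (C \in nb _ _)) => //= /nbP[x xX /andP[_ eC]]; rewrite in_setU.
    case: (boolP (C \in W)) => //= CW; apply/nbP; exists x => //.
    by rewrite /hit in_setD CW CM.
  move/subset_leq_card/leq_trans => /(_ _ (leq_trans (eq_leq (cardsU _ _)) (leq_subr _ _))) h1.
  have h2 : #|W :|: nb (hit e N) X| <= size ps * (2 * h) + #|nb (hit e N) X|.
    apply: leq_trans (leq_trans (eq_leq (cardsU _ _)) (leq_subr _ _)) _.
    by rewrite leq_add2r.
  have h3 := few_missed (ltnW kX).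
  have h4 : (size ps).+1 * (2 * h) <= #|P| * (2 * h) by rewrite leq_mul2r ps_size orbT.
  have h5 := leq_ltn_trans h1 (leq_add h3 h2 : _ < _).
  have h6 := leq_ltn_trans M_large h5.
  have h7 := leq_ltn_trans (leq_add h4 (leqnn (9 * k))) h6.
  by move: h7 X2k; clear; lia.
have /cards2P[a [b [ab BE]]] : #|B| == 2 by rewrite P_size.
have k_gt0 : 0 < k by rewrite kE expn_gt0.
have N_le2 C : C \in N -> #|C| <= 2.
  by move=> /(subsetP NM) /M_size /andP[].
have aB : a \in B by rewrite BE !inE eqxx.
have bB : b \in B by rewrite BE !inE eqxx orbT.
have BM x : x \in B -> x \notin cover M by move=> xB; apply/cover_disj/(mem_cover BP).
have BN x : x \in B -> x \notin cover N.
  by move=> xB; apply: contra (BM x xB); apply/subsetP/coverS.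
have [s [sN sU szs sE Hexp]] := link_pair N_le2 N_triv NY k_gt0 slack e_sym kE e_joined
  (BY _ aB) (BY _ bB) (BN _ aB) (BN _ bB) ab WY.
set S := [set C in _] in Hexp.
have sM : all (fun p => pair_set p \in M) s.
  by apply/allP => p /(allP sN); exact: (subsetP NM).
have SN : S \subset N.
  by apply/subsetP => C; rewrite in_set => /mapP[p /(allP sN) pN ->].
have SM : S \subset M := subset_trans SN NM.
pose f' C := if C == B then s else f C.
have f'B : f' B = s by rewrite /f' eqxx.
have f'ps C : C \in ps -> f' C = f C.
  by move=> Cps; rewrite /f'; case: eqVneq Cps Bps => // -> ->.
have SW x : x \in cover S -> x \notin cover W.
  move=> /bigcupP[C CS xC]; apply/bigcupP => -[D DW xD].
  have := subsetP SN C CS; rewrite in_setD => /andP[/negP CW CM].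
  by apply: CW; rewrite (mem_pair_eq M_triv CM (subsetP WM D DW) xC xD).
have disj_new C : C \in ps -> [disjoint trace f' B & trace f' C].
  move=> Cps; rewrite /trace f'B f'ps //; have [_ /subsetP fW] := fps C Cps.
  have CP := psP C Cps; have nBC : B != C by apply: contraNneq Bps => ->.
  rewrite -setI_eq0; apply/eqP/setP => x; rewrite in_set0 in_setI !in_setU.
  (* Distinct pairs of [P] are disjoint, their vertices avoid [cover M], and the new stops avoid
     [cover W], which contains the old ones. *)
  apply/negP => /andP[/orP[xB | xs] /orP[xC | xf]].
  - by case/eqP: nBC; exact: (mem_pair_eq P_triv BP CP xB xC).
  - by case/negP: (BM x xB); apply: (subsetP (coverS WM)); exact: fW.
  - case/negP: (cover_disj (mem_cover CP xC)); apply: (subsetP (coverS SM)).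
    exact: (subsetP (stop_vertices_sub s)).
  - case/negP: (SW x (subsetP (stop_vertices_sub s) x xs)); exact: fW.
exists f', (W :|: S); split.
- by rewrite subUset WM SM.
- apply: leq_trans (leq_trans (eq_leq (cardsU _ _)) (leq_subr _ _)) _.
  rewrite /= mulSn addnC leq_add //.
  by rewrite cardsE (card_uniqP sU) size_map szs.
- rewrite -setDDl; apply: expands_sub Hexp; apply/subsetP => x.
  rewrite !in_setD !in_setU !negb_or => /andP[/andP[xWS xBps] ->].
  rewrite andbT; apply/andP; split; last first.
    rewrite (contra (subsetP (coverS (subsetUl W S)) x) xWS) /=.
    apply: contra xBps => /bigcupP[C]; rewrite in_set => Cps xC.
    by apply: mem_cover xC; rewrite in_set in_cons Cps orbT.
  rewrite (contra (subsetP (coverS (subsetUr W S)) x) xWS) andbT.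
  rewrite -negb_or -in_setU -BE; apply: contra xBps => xB.
  by apply: mem_cover xB; rewrite in_set mem_head.
- move=> C; rewrite in_cons => /orP[/eqP -> | Cps].
    rewrite f'B; split; last first.
      exact: subset_trans (stop_vertices_sub s) (coverS (subsetUr W S)).
    by exists a, b; split=> //; split=> //; apply: uniq_alt_vertices => //; exact: BM.
  rewrite f'ps //; have [lC fC] := fps C Cps; split=> //.
  exact: subset_trans fC (coverS (subsetUl W S)).
- move=> C D; rewrite !in_cons => /orP[/eqP -> | Cps] /orP[/eqP -> | Dps].
  + by rewrite eqxx.
  + by move=> _; exact: disj_new.
  + by move=> _; rewrite disjoint_sym; exact: disj_new.
  + by rewrite /trace !f'ps //; exact: fdisj.
Qed.

Lemma link_pairs :
  exists f : {set T} -> seq (T * T),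
    (forall B, B \in P -> exists a b, B = [set a; b] /\ alt_path e M a b (f B)) /\
    (forall B B', B \in P -> B' \in P -> B != B' ->
      [disjoint B :|: stop_vertices (f B) & B' :|: stop_vertices (f B')]).
Proof.
have [|f [W [_ _ _ fP fdisj]]] := link_seq (enum_uniq P).
  by move=> B; rewrite mem_enum.
exists f; split=> [B BP | B B' BP B'P]; last by apply: fdisj; rewrite mem_enum.
by have [] := fP B; rewrite ?mem_enum.
Qed.

End LinkPairs.

(** * Parameters of an (n, d, lambda)-graph *)

Section SpectralExpansion.
Variables (R : realType) (T : finType) (e : rel T) (d : nat) (lam : R).
Hypothesis G : nd_lambda_graph e d lam.
Hypothesis T2 : (2 <= #|T|)%N.
Hypothesis lam_d : 500 * lam < d%:R.

Let n : R := #|T|%:R.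
(* Any two vertex sets with more than [m] vertices are joined by an edge. *)
Let m : R := lam * n / d%:R.

(** Two vertices give a second eigenvalue, whose absolute value is at most [lam]. *)
Lemma second_eig_ge0 : 0 <= lam.
Proof.
have [_ _ [s [chs _ s_le]]] := G.
have ss : size s = #|T|.
  by apply: succn_inj; rewrite -(size_prod_XsubC s id) -chs size_char_poly.
by apply: le_trans (normr_ge0 s`_1) (s_le 1%N _); rewrite ss.
Qed.

Lemma order_gt0 : 0 < n. Proof. by rewrite ltr0n; exact: leq_trans T2. Qed.

Lemma degree_gt0 : 0 < d%:R :> R.
Proof. by have := second_eig_ge0; have := lam_d; lra. Qed.

Lemma lam_lt_d : lam < d%:R.
Proof. by have := second_eig_ge0; have := lam_d; lra. Qed.

Lemma mixing_bound (A B : {set T}) :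
  ((edges_between e A B)%:R - d%:R * #|A|%:R * #|B|%:R / n) ^+ 2
    <= lam ^+ 2 * (#|A|%:R * #|B|%:R).
Proof. exact: (expander_mixing A B G second_eig_ge0 lam_lt_d). Qed.

Lemma lam_eq : lam = m * d%:R / n.
Proof. by rewrite /m; field; rewrite !gt_eqF ?order_gt0 ?degree_gt0. Qed.

Lemma threshold_ge0 : 0 <= m.
Proof.
by rewrite /m !mulr_ge0 ?invr_ge0 ?second_eig_ge0 ?(ltW order_gt0) ?(ltW degree_gt0).
Qed.

(** Without edges the mixing bound reads [(c * t) ^+ 2 <= lam ^+ 2 * t], where c = d/n and [t] is
    the product of the sizes. As lam = c m, cancelling [c ^+ 2 * t] leaves [t <= m ^+ 2]. *)
Lemma no_edges_small (A B : {set T}) :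
  edges_between e A B = 0%N -> (#|A| * #|B|)%:R <= m ^+ 2.
Proof.
move=> AB0; have := mixing_bound A B; rewrite AB0 sub0r sqrrN natrM.
set t : R := _ * #|B|%:R => H.
have [t0 | t_gt0] := leP t 0; first by apply: le_trans t0 (sqr_ge0 m).
have c0 : 0 < (d%:R / n) ^+ 2 by rewrite exprn_gt0 // divr_gt0 ?order_gt0 ?degree_gt0.
have : (d%:R / n) ^+ 2 * t * t <= (d%:R / n) ^+ 2 * m ^+ 2 * t.
  apply: le_trans (le_trans _ H) _; rewrite le_eqVlt; apply/orP; left; apply/eqP.
    by rewrite /t; ring.
  by rewrite {1}lam_eq; ring.
by rewrite ler_pM2r // ler_pM2l.
Qed.

(** A single vertex has no edge to itself, so the previous bound applies to two copies of it. *)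
Lemma threshold_ge1 : 1 <= m.
Proof.
have [v _] : exists v : T, v \in T by apply/card_gt0P; exact: leq_trans T2.
have [[_ eirr] _ _] := G.
have := @no_edges_small [set v] [set v].
rewrite !cards1 -{1}(expr1n _ 2) ler_pXn2r ?nnegrE ?threshold_ge0 //; apply.
rewrite /edges_between big_set1; apply/eqP; rewrite cards_eq0.
by apply/eqP/setP => u; rewrite !inE; apply/andP => -[evu /eqP uv]; rewrite uv eirr in evu.
Qed.

Lemma joined (k : nat) (X X' : {set T}) : m < k%:R -> (k <= #|X|)%N -> (k <= #|X'|)%N ->
  exists x x', [/\ x \in X, x' \in X' & e x x'].
Proof.
move=> mk kX kX'; have [[esym _] _ _] := G.
suff /existsP[x /existsP[x' /and3P[*]]] :
  [exists x, exists x', [&& x \in X, x' \in X' & e x x']].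
  by exists x, x'.
apply: contraLR mk => none; rewrite -leNgt.
have : (#|X| * #|X'|)%:R <= m ^+ 2.
  apply: no_edges_small; apply: big1 => v vX'; apply/eqP; rewrite cards_eq0.
  apply/eqP/setP => u; rewrite !inE; apply/andP => -[evu uX].
  by case/existsP: none; exists u; apply/existsP; exists v; rewrite uX vX' esym.
move=> H; rewrite -(@ler_pXn2r _ 2) ?nnegrE ?threshold_ge0 //; apply: le_trans H.
by rewrite -natrX ler_nat expnS expn1 leq_mul.
Qed.

Lemma doubling_scale : exists h : nat, m < (2 ^ h)%:R /\ (2 ^ h)%:R <= 2 * m.
Proof.
have ex : exists h, m < (2 ^ h)%:R.
  exists (Num.truncn m).+1; apply: lt_le_trans (truncnS_gt m) _.
  by rewrite ler_nat ltnW // ltn_expl.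
(* Minimality of [h] gives the upper bound; when [h] is 0 it follows from [1 <= m]. *)
case: (ex_minnP ex) => h mh h_min; exists h; split=> //.
case: h mh h_min => [|h] mh h_min; first by have := threshold_ge1; rewrite expn0; lra.
have : ~~ (m < (2 ^ h)%:R) by apply/negP => /h_min; rewrite ltnn.
by rewrite -leNgt expnS natrM; lra.
Qed.

(** If [X] met fewer than [2 * #|X|] pairs, its [500 * lam * #|X|] or more edges into [cover M]
    would end in a set [A] of at most [4 * #|X| <= 16 * m] vertices; mixing allows only
    [16 * lam * #|X|] plus an error of [2 * lam * #|X|]. *)
Lemma clean_expands (k : nat) (M P : {set {set T}}) :
  (forall B, B \in M -> (0 < #|B| <= 2)%N) ->
  clean e (500 * lam) (cover M) ->
  (forall v, v \in cover P -> 500 * lam <= (#|nbhd e v :&: cover M|)%:R) ->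
  k%:R <= 2 * m ->
  expands (hit e M) (cover M :|: cover P) k.
Proof.
move=> M_size M_clean P_clean km X XY X2k; rewrite leqNgt; apply/negP => small.
set D := nb (hit e M) X in small.
pose A := cover D.
have A4 : (#|A| <= 4 * #|X|)%N.
  apply: (leq_trans (leq_card_cover D)).
  apply: leq_trans (_ : \sum_(B in D) 2 <= _)%N.
    by apply: leq_sum => B /nbP[x _ /andP[BM _]]; have /andP[] := M_size B BM.
  by rewrite sum_nat_const; move: small; clear; lia.
have E_ge : 500 * lam * #|X|%:R <= (edges_between e A X)%:R.
  rewrite mulr_natr -sumr_const /edges_between natr_sum; apply: ler_sum => v vX.
  have vM : 500 * lam <= #|nbhd e v :&: cover M|%:R.
    by have := subsetP XY v vX; rewrite in_setU => /orP[/M_clean | /P_clean].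
  apply: le_trans vM _; rewrite ler_nat; apply/subset_leq_card/subsetP => u.
  rewrite !in_setI => /andP[uv /bigcupP[B BM uB]]; rewrite uv /=.
  apply: (mem_cover _ uB); apply/nbP; exists v => //; rewrite /hit BM.
  by apply/exists_inP; exists u => //; move: uv; rewrite in_set.
have X_gt0 : 0 < #|X|%:R :> R by rewrite ltr0n; move: small; clear; lia.
have X4m : #|X|%:R <= 4 * m.
  have : #|X|%:R <= (2 * k)%:R :> R by rewrite ler_nat.
  by rewrite natrM; move: km; lra.
have A4R : #|A|%:R <= 4 * #|X|%:R :> R by rewrite -natrM ler_nat.
have lam0 := second_eig_ge0.
pose c : R := d%:R / n.
have c_gt0 : 0 < c by rewrite divr_gt0 ?order_gt0 ?degree_gt0.
have lamE : lam = c * m by rewrite {1}lam_eq /c; ring.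
have lam_gt0 : 0 < lam by rewrite lamE mulr_gt0 //; have := threshold_ge1; lra.
have main_term : d%:R * #|A|%:R * #|X|%:R / n <= 16 * lam * #|X|%:R.
  have -> : d%:R * #|A|%:R * #|X|%:R / n = c * #|A|%:R * #|X|%:R by rewrite /c; ring.
  rewrite ler_wpM2r ?ler0n // {1}lamE mulrCA ler_wpM2l ?(ltW c_gt0) //.
  by move: A4R X4m; lra.
have error_term : (edges_between e A X)%:R - d%:R * #|A|%:R * #|X|%:R / n <= 2 * lam * #|X|%:R.
  rewrite leNgt; apply/negP => lt; have := mixing_bound A X; rewrite leNgt => /negP; apply.
  apply: (@le_lt_trans _ _ ((2 * lam * #|X|%:R) ^+ 2)); last first.
    rewrite ltr_pXn2r ?nnegrE ?mulr_ge0 //.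
    by apply: le_trans (ltW lt); rewrite !mulr_ge0.
  have -> : (2 * lam * #|X|%:R) ^+ 2 = lam ^+ 2 * ((4 * #|X|%:R) * #|X|%:R) by ring.
  by rewrite ler_wpM2l ?sqr_ge0 // ler_wpM2r.
have lamX : 0 < lam * #|X|%:R by rewrite mulr_gt0.
by move: E_ge main_term error_term lamX; lra.
Qed.

(** From [2 ^ h <= 2 * m <= n] follows [h <= L], so the links use at most [#|M| / 50] pairs, while
    [9 * k <= 18 * m] is at most [9 * #|M| / 1000]. *)
Lemma pairs_fit (h k : nat) (M P : {set {set T}}) :
  k = (2 ^ h)%N -> k%:R <= 2 * m ->
  2000 * lam * n / d%:R <= #|M|%:R ->
  #|P|%:R <= #|M|%:R / (100 * (ln n / ln 2)) ->
  (#|P| * (2 * h) + 9 * k <= #|M|)%N.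
Proof.
move=> kE km Mm PM.
have ln2_gt0 : 0 < ln 2 :> R by rewrite ln_gt0 // ltr1n.
set L := ln n / ln 2 in PM.
have mn : 2 * m <= n.
  rewrite /m mulrA ler_pdivrMr ?degree_gt0 // [leLHS]mulrA [leLHS]mulrC.
  rewrite ler_wpM2l ?(ltW order_gt0) //.
  by have := lam_d; have := second_eig_ge0; lra.
have hL : h%:R <= L.
  rewrite ler_pdivlMr // mulr_natl -lnXn ?ltr0n // ler_ln ?posrE ?exprn_gt0 ?order_gt0 //.
  by rewrite -natrX -kE; exact: le_trans mn.
have L_gt0 : 0 < L by rewrite divr_gt0 // ln_gt0 // ltr1n.
have PL : #|P|%:R * L <= #|M|%:R / 100.
  have -> : #|M|%:R / 100 = #|M|%:R / (100 * L) * L :> R.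
    by field; rewrite gt_eqF.
  by rewrite ler_wpM2r // ltW.
have Ph : #|P|%:R * h%:R <= #|P|%:R * L :> R by rewrite ler_wpM2l.
have Mm' : 2000 * m <= #|M|%:R by apply: le_trans Mm; rewrite /m !mulrA.
rewrite -(ler_nat R) natrD !natrM.
by move: PL Ph Mm' km; have := threshold_ge1; lra.
Qed.

End SpectralExpansion.

Theorem theorem3p18 (R : realType) :
  exists n0 : nat,
  forall (T : finType) (e : rel T) (d : nat) (lam : R)
         (M P : {set {set T}}),
    (n0 <= #|T|)%N ->
    nd_lambda_graph e d lam ->
    500 * lam < d%:R ->
    (* M: pairwise disjoint pairs {x,y}, x = y allowed *)
    (forall B, B \in M -> (0 < #|B| <= 2)%N) ->
    finset.trivIset M ->
    clean e (500 * lam) (finset.cover M) ->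
    2000 * lam * (#|T|)%:R / d%:R <= (#|M|)%:R ->
    (* P: pairwise disjoint pairs {a_i,b_i} of distinct vertices outside V(M) *)
    (forall B, B \in P -> #|B| = 2%N) ->
    finset.trivIset P ->
    [disjoint finset.cover P & finset.cover M] ->
    (#|P|)%:R <= (#|M|)%:R / (100 * (ln ((#|T|)%:R : R) / ln (2 : R))) ->
    (forall v, v \in finset.cover P -> 500 * lam <= (#|nbhd e v :&: finset.cover M|)%:R) ->
    exists f : {set T} -> seq (T * T),
      (forall B, B \in P ->
         exists a b, B = [set a; b] /\ alt_path e M a b (f B)) /\
      (forall B B', B \in P -> B' \in P -> B != B' ->
         [disjoint B :|: stop_vertices (f B) & B' :|: stop_vertices (f B')]).
Proof.
(* Two vertices ensure a second eigenvalue, hence [0 <= lam], and make [ln n] positive. *)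
exists 2%N => T e d lam M P T2 G lam_d M_size M_triv M_clean Mm P_size P_triv PM Pm P_clean.
have [h [mk km]] := doubling_scale G T2 lam_d.
have [[esym _] _ _] := G.
apply: (@link_pairs T e M P M_size M_triv (2 ^ h) _ h erefl esym P_size P_triv PM).
- by move=> X X'; exact: (joined G T2 lam_d).
- exact: (clean_expands G T2 lam_d).
- have H := pairs_fit G T2 lam_d (erefl (2 ^ h)%N) km Mm Pm; exact: H.
Qed.
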